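(* There is a sequence $(g_\alpha\mid\alpha<\omega_1)\subseteq\{0,1,2\}^{\mathbb{N}}$ and a coloring $c:[\omega_1]^2\to\mathbb{N}$ (writing $c(\alpha,\beta)$ for $c(\{\alpha,\beta\})$) such that: (1) for all $\beta<\alpha<\omega_1$ and all $k>c(\beta,\alpha)$ we have $\{g_\beta(k),g_\alpha(k)\}\neq\{1,2\}$; (2) for all $\beta<\alpha<\omega_1$ we have $g_\beta(c(\beta,\alpha))=1$ and $g_\alpha(c(\beta,\alpha))=2$; (3) for all $\gamma<\beta<\alpha<\omega_1$, if $c(\gamma,\beta)>c(\alpha,\beta)$ then $c(\gamma,\beta)=c(\gamma,\alpha)$; (4) for all $\alpha<\omega_1$ and all $m\in\mathbb{N}$ the set $\{\beta<\alpha\mid c(\beta,\alpha)<m\}$ is finite; (5) for all $\alpha<\omega_1$ the sets $g_\alpha^{-1}[\{1\}]$ and $g_\alpha^{-1}[\{2\}]$ are infinite.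
   Context: $[\omega_1]^2$ denotes the set of two-element subsets of $\omega_1$. *)

(* Defs.v *)
From HB Require Import structures.
From mathcomp Require Import all_boot all_order.
From mathcomp Require Import all_classical.
From mathcomp Require Import wochoice.

Set Implicit Arguments.
Unset Strict Implicit.
Unset Printing Implicit Defensive.

Import Order.TTheory.
Local Open Scope classical_set_scope.
Local Open Scope card_scope.

(* [T] is a copy of the ordinal omega_1: an uncountable well-order all of whose
   proper initial segments are countable.  This determines [T] up to a unique
   order isomorphism, and [omega1_exists] below shows that such a [T] exists. *)
Definition is_omega1 (d : Order.disp_t) (T : orderType d) : Prop :=
  [/\ well_order (<=%O : rel T),
      ~ countable [set: T]
    & forall a : T, countable [set b : T | (b < a)%O]].

Definition two_subsets (T : Type) : set (set T) := [set A | A #= `I_2].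
Arguments two_subsets T : clear implicits.

(* [col c x y] is c({x,y}).  It takes the default value 0 on the diagonal,
   where {x,y} is not a two-element set. *)
Definition col (T : Type) (c : two_subsets T -> nat) (x y : T) : nat :=
  oapp c 0 (insub [set x; y]).

Lemma two_subsetsP (T : Type) (x y : T) :
  x <> y -> [set x; y] \in two_subsets T.
Proof.
move=> xy; apply/mem_set; rewrite /two_subsets /=; apply/card_set_bijP.
exists (fun z => if `[< z = x >] then 0 else 1); split.
- by move=> z _; case: ifP.
- move=> u v /set_mem uxy /set_mem vxy.
  case: asboolP => [->|ux]; case: asboolP => [->|vx] // _.
  by case: uxy => // ->; case: vxy => // ->.
- move=> [|[|//]] _; first by exists x; [left|case: asboolP].
  by exists y; [right|case: asboolP => // yx; case: xy].
Qed.

Lemma colE (T : Type) (c : two_subsets T -> nat) (x y : T) (xy : x <> y) :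
  col c x y = c (exist _ [set x; y] (two_subsetsP xy)).
Proof.
rewrite /col; case: insubP => [u _ uxy /=|]; last by rewrite two_subsetsP.
by congr c; apply: val_inj.
Qed.

Lemma colC (T : Type) (c : two_subsets T -> nat) (x y : T) :
  col c x y = col c y x.
Proof. by rewrite /col setUC. Qed.

Lemma omega1_exists :
  exists (d : Order.disp_t) (T : orderType d), is_omega1 T.
Proof.
have [R woR] := well_ordering_principle (set nat).
have RT : forall A : set (set nat), A !=set0 ->
    exists2 z, A z & forall x, A x -> R z x.
  move=> A [a Aa].
  have [|z [[zA zm] _]] := woR (fun x => x \in A); first by exists a; apply/mem_set.
  by exists z => [|x Ax]; [exact/set_mem|apply/zm/mem_set].
have woC : wo_chain R predT by move=> A _; exact: woR.
have Rr : reflexive R by move=> x; exact: (wo_chain_reflexive woC).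
have Ra : antisymmetric R.
  by move=> x y; exact: (wo_chain_antisymmetric woC).
have Rt : total R by move=> x y; exact: (wo_chainW woC).
have Rtr : transitive R.
  move=> y x z Rxy Ryz.
  have [|w wA wm] := RT [set x; y; z]; first by exists x; left; left.
  have [Rwx Rwy Rwz] : [/\ R w x, R w y & R w z].
    by split; apply: wm; [left; left|left; right|right].
  case: wA => [[]|] /= wE; subst w => //.
    by rewrite (Ra x y) ?Rxy.
  by rewrite -(Ra y z) ?Ryz.
pose S := [set y | countable [set x | R x y]].
have Sunc : ~ countable S.
  have unc : ~ countable [set: set nat].
    move=> /pcard_leTP/unsquash f.
    have fi : injective f by move=> x y; apply: (@inj _ _ _ f); rewrite in_setT.
    pose D := [set n | exists2 A, f A = n & ~ A n].
    have [DD|DD] := pselect (D (f D)); last by apply: (DD); exists D.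
    by have [A /fi AD nA] := DD; rewrite AD in nA.
  move=> cS; have [ST|] := pselect (S = setT); first by rewrite ST in cS.
  rewrite -subTset => /existsNP [a]; rewrite not_implyE => -[_ Sa].
  have [|z Sz zm] := RT (~` S); first by exists a.
  apply: Sz; pose F (b : bool) := if b then S else [set z].
  apply: (@sub_countable _ _ _ (\bigcup_b F b)); last first.
    by apply: bigcup_countable => // -[] _; [|exact: countable1].
  apply: subset_card_le => x /= Rxz.
  have [Sx|Sx] := pselect (S x); [by exists true|exists false => //].
  by apply: Ra; rewrite Rxz zm.
have Scnt y : S y -> countable [set x | R x y] by [].
clearbody S.
pose leS : rel S := fun x y => R (val x) (val y).
have leSr : reflexive leS by move=> x; exact: Rr.
have leSa : antisymmetric leS by move=> x y xy; apply: val_inj; exact: Ra.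
have leSt : transitive leS by move=> y x z; exact: Rtr.
pose po := Order.Le_isPOrder.Build (Order.Disp tt tt) S leSr leSa leSt.
pose PS : porderType (Order.Disp tt tt) := HB.pack {x : set nat | x \in S} po.
have leStot : total (<=%O : rel PS) by move=> x y; exact: Rt.
pose tot := Order.POrder_isTotal.Build _ PS leStot.
pose OS : orderType (Order.Disp tt tt) := HB.pack PS tot.
exists (Order.Disp tt tt), OS; split.
- move=> A [a Aa].
  have [|_ [z Az <-] zm] := RT [set val x | x in [set x : S | x \in A]].
    by exists (val a), a.
  have mz : minimum_of (<=%O : rel OS) A z.
    by split=> // x Ax; apply: zm; exists x.
  exists z; split=> // t [At mt]; apply: (leSa); apply/andP; split.
    exact: mz.2.
  exact: mt.
- by rewrite (eq_countable (card_setT S)).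
- move=> a; have Sa : countable [set x | R x (val a)] by apply: Scnt; exact: set_valP.
  apply: sub_countable Sa.
  have Sinj : {in [set b : OS | (b < a)%O] &, injective (val : S -> set nat)}.
    by move=> x y _ _; exact: val_inj.
  rewrite -(card_le_eql (inj_card_eq Sinj)).
  apply: subset_card_le => _ [b /ltW ba <-]; exact: ba.
Qed.

(* Main.v *)
Require Import Defs.
From mathcomp Require Import all_boot all_order.
From mathcomp Require Import all_classical.
From mathcomp Require Import wochoice zify.

(** On a well-order with a bottom point and countable initial segments, one
    constructs [g_a] and [c(.,a)] by recursion on [a].  The recursion keeps [c]
    an ultrametric-like function (subadditive, as Todorcevic's rho), so that
    [P_l(a) = {r <= a | c(r,a) < l}] is finite and [P_l(b)] is
    the part of [P_l(a)] up to [b] whenever [c(b,a) < l].  The invariant that makes the recursion go through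
    is a richness property: for all [x <= a] there are infinitely many levels
    [l] at which [g_r(l) = 0] for [r <= x] in [P_l(a)] and [g_r(l) = 1] for
    [x < r] in [P_l(a)].

    To add a point [t], build level by level a weakly increasing sequence
    [b_0, b_1, ...] below [t].  At most levels [g_t] imitates the current
    [b_j]; at a level [l] that is rich for [b_j < b'], one may put [g_t(l) = 2]
    and jump from [b_j] to [b']: the points of [P_l(b_j)] carry 0, and exactly
    the newly acquired points of [P_l(b')] carry 1.  Then [c(r,t)] is the first
    level at which [r] is acquired.  Bookkeeping over the countably many points
    below [t] makes the sequence cofinal and makes [t] rich.

    The bottom point, the only one escaping (2), is removed by shifting along
    the successor function. *)

Set Implicit Arguments.
Unset Strict Implicit.
Unset Printing Implicit Defensive.

Import Order.TTheory.
Local Open Scope classical_set_scope.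

(** * Recursion along a well-order, enumerations and colorings of pairs *)

(** Well-founded recursion in which the value at [x] is merely chosen to satisfy [Q]. Locality of
    [Q] lets the partial function built so far be completed arbitrarily. *)
Lemma wf_sequence (X : Type) (D : choiceType) (lt : X -> X -> Prop)
    (Q : (X -> D) -> X -> Prop) :
  well_founded lt -> D ->
  (forall h h' x, (forall y, lt y x \/ y = x -> h y = h' y) -> Q h x -> Q h' x) ->
  (forall h x, (forall y, lt y x -> Q h y) ->
     exists v, Q (fun y => if `[< y = x >] then v else h y) x) ->
  exists h, forall x, Q h x.
Proof.
move=> wf d0 Qloc Qstep.
have ltxx x : ~ lt x x by elim: (wf x) => {}x _ IH xx; exact: (IH x xx xx).
(* Points not below [x] all receive [v]; by locality only its value at [x] itself matters. *)
pose ext x (rec : forall y, lt y x -> D) v y :=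
  if pselect (lt y x) is left yx then rec y yx else v.
pose F x rec := xget d0 [set v | Q (@ext x rec v) x].
pose h := Fix wf (fun=> D) F.
have hE x : h x = F x (fun y _ => h y).
  apply: (Fix_eq wf (fun=> D)) => {}x f1 f2 f12; rewrite /F; congr xget.
  suff -> : f1 = f2 by [].
  by apply/functional_extensionality_dep => y; apply: funext => yx; exact: f12.
exists h => x; elim: (wf x) => {}x _ IH.
have [v Qv] := Qstep h x IH.
have : Q (ext x (fun y _ => h y) (h x)) x.
  rewrite (hE x); apply: (@xgetPex _ d0 [set v | Q (ext x (fun y _ => h y) v) x]).
  exists v; apply: Qloc Qv => y yx; rewrite /ext; case: pselect => ltyx.
    by case: asboolP => // yE; rewrite yE in ltyx; case: (ltxx x).
  by case: asboolP => // -[]; case: yx.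
by apply: Qloc => y [|->]; rewrite /ext; case: pselect.
Qed.

Lemma wo_lt_wf (d : Order.disp_t) (T : orderType d) :
  well_order (<=%O : rel T) -> well_founded (fun x y : T => (x < y)%O).
Proof.
move=> wo x; apply: contrapT => nx.
have [|z [[zN zm] _]] := wo (fun y => `[< ~ Acc (fun x y : T => (x < y)%O) y >]).
  by exists x; apply/asboolP.
move/asboolP: zN => []; constructor => y yz; apply: contrapT => ny.
by have := zm y; rewrite leNgt yz => /(_ (asboolT ny)).
Qed.

Lemma wo_min (d : Order.disp_t) (T : orderType d) (A : set T) :
  well_order (<=%O : rel T) -> A !=set0 ->
  exists2 z, A z & forall x, A x -> (z <= x)%O.
Proof.
move=> wo [a Aa]; have [|z [[zA zm] _]] := wo (fun x => x \in A).
  by exists a; apply/mem_set.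
by exists z => [|x Ax]; [exact/set_mem|apply/zm/mem_set].
Qed.

(** [e n] is the element whose code is the 2-adic valuation of [n], and each valuation recurs at
    arbitrarily large [n]. *)
Lemma countable_enum_inf (T : choiceType) (A : set T) (a : T) :
  A a -> countable A ->
  exists e : nat -> T, (forall n, A (e n)) /\
    forall x N, A x -> exists2 n, (N <= n)%N & e n = x.
Proof.
move=> Aa /countable_injP[f finj].
pose e n := xget a [set x | A x /\ f x = logn 2 n].
exists e; split=> [n|x N Ax].
  by rewrite /e; case: xgetP => [x _ []|].
exists (2 ^ f x * N.*2.+1); first nia.
have lE : logn 2 (2 ^ f x * N.*2.+1) = f x.
  rewrite lognM ?expn_gt0 // lognX logn_prime // muln1 lognE /= dvdn2 /=.
  by rewrite odd_double addn0.
rewrite /e lE; case: xgetP => [y _ [Ay fy]|/(_ x)]; last by case.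
by apply: finj => //; apply/mem_set.
Qed.

(** A two-element set has a single increasing enumeration, so [cc] on increasing pairs is
    unambiguous. *)
Lemma exists_col (d : Order.disp_t) (T : orderType d) (cc : T -> T -> nat) :
  exists c : two_subsets T -> nat, forall x y, (x < y)%O -> col c x y = cc x y.
Proof.
pose c (u : two_subsets T) :=
  xget 0 [set n | exists x y, [/\ (x < y)%O, val u = [set x; y] & n = cc x y]].
exists c => x y xy; have nxy : x <> y by move=> E; rewrite E ltxx in xy.
rewrite (colE _ nxy) /c; case: xgetP => [n _ /= [x' [y' [xy' E ->]]]|].
  have [xx|xx] : [set x'; y'] x by rewrite -E; left.
    have [yy|yy] : [set x'; y'] y by rewrite -E; right.
      by rewrite xx yy ltxx in xy.
    by rewrite xx yy.
  have [yy|yy] : [set x'; y'] y by rewrite -E; right.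
    by rewrite xx yy in xy; have := lt_trans xy xy'; rewrite ltxx.
  by rewrite xx yy ltxx in xy.
by move=> /(_ (cc x y)) []; exists x, y.
Qed.

Lemma countable_le (d : Order.disp_t) (T : orderType d) (a : T) :
  countable [set x : T | (x < a)%O] -> countable [set x : T | (x <= a)%O].
Proof.
move=> ca; pose F (i : bool) := if i then [set x : T | (x < a)%O] else [set a].
apply: (@sub_countable _ _ _ (\bigcup_i F i)); last first.
  by apply: bigcup_countable => // -[] _; [|exact: countable1].
apply: subset_card_le => x /=; rewrite le_eqVlt => /predU1P[xa|xa].
  by exists false.
by exists true.
Qed.

(** * Coherent families and their rich levels *)

(** On P_l(a), [g] at level [l] is the indicator of the points above [x] (a boolean read as a
    number), and [x] itself belongs to P_l(a). *)
Definition good (d : Order.disp_t) (T : orderType d)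
    (g : T -> nat -> nat) (c : T -> T -> nat) (x a : T) (l : nat) : Prop :=
  (c x a < l)%N /\
  forall r, (r <= a)%O -> (c r a < l)%N -> g r l = (x < r)%O :> nat.

(* Only the values [c b a] with [b <= a] matter; [c a a = 0] is a convention. *)
Record coherent (d : Order.disp_t) (T : orderType d) (bot : T)
    (g : T -> nat -> nat) (c : T -> T -> nat) (a : T) : Prop := Coherent {
  coh_self : c a a = 0;
  coh_bot : c bot a = 0;
  coh_col : forall b, (bot < b)%O -> (b < a)%O ->
    g b (c b a) = 1 /\ g a (c b a) = 2;
  coh_free : forall b k, (b < a)%O -> (c b a < k)%N ->
    ~ (g b k = 1 /\ g a k = 2) /\ ~ (g b k = 2 /\ g a k = 1);
  coh_ultra : forall r b, (r < b)%O -> (b < a)%O ->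
    (c r a <= maxn (c r b) (c b a))%N;
  coh_tree : forall r b, (r < b)%O -> (b < a)%O ->
    (c r b <= maxn (c r a) (c b a))%N;
  coh_fin : forall m, finite_set [set b | (b < a)%O /\ (c b a < m)%N];
  coh_rich : forall x m, (x <= a)%O -> exists2 l, (m < l)%N & good g c x a l
}.

(** This is the locality that [wf_sequence] requires; the recursion at [b] fixes the whole column of
    values [c r b]. *)
Lemma coherent_local (d : Order.disp_t) (T : orderType d) (bot : T)
    (g g' : T -> nat -> nat) (c c' : T -> T -> nat) (a : T) :
  (forall b, (b <= a)%O -> g b = g' b) ->
  (forall r b, (b <= a)%O -> c r b = c' r b) ->
  coherent bot g c a -> coherent bot g' c' a.
Proof.
move=> eg ec [H1 H2 H3 H4 H5 H6 H7 H8].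
have ega := eg a (lexx a); have eca r := ec r a (lexx a).
split.
- by rewrite -eca.
- by rewrite -eca.
- by move=> b bb ba; rewrite -eca -ega -eg ?ltW //; exact: H3.
- by move=> b k ba; rewrite -eca -ega -eg ?ltW //; exact: H4.
- by move=> r b rb ba; rewrite -!eca -ec ?ltW //; exact: H5.
- by move=> r b rb ba; rewrite -!eca -ec ?ltW //; exact: H6.
- move=> m; rewrite (_ : [set b | _] = [set b | (b < a)%O /\ (c b a < m)%N]) //.
  by apply/seteqP; split=> b /=; rewrite eca.
- move=> x m xa; have [l ml [cl gl]] := H8 x m xa; exists l => //.
  by split=> [|r ra]; rewrite -eca // -eg //; exact: gl.
Qed.

Lemma good_top (d : Order.disp_t) (T : orderType d) (bot : T) g c (x a : T) l :
  coherent bot g c a -> (0 < l)%N -> good g c x a l -> g a l = (x < a)%O :> nat.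
Proof. by move=> ca l0 [_]; apply=> //; rewrite (coh_self ca). Qed.

(** * The approximating sequence below a new point *)

(* The moves at level [l] of the sequence approximating the new point [t], with
   [w = g_t(l)]: imitate [b], imitate [b] but put 1, or jump to [b']. *)
Definition path_step (d : Order.disp_t) (T : orderType d)
    (g : T -> nat -> nat) (c : T -> T -> nat) (b b' : T) (l w : nat) : Prop :=
  [\/ b' = b /\ w = (if g b l == 2 then 2 else 0),
      [/\ b' = b, w = 1 & exists2 x, (x <= b)%O & good g c x b l]
    | [/\ (b < b')%O, w = 2 & good g c b b' l]].

(** Every point up to [t] recurs in the list of requirements. The first time [x] below [t] is met
    the sequence reaches or has passed [x]; later times yield levels with value 1, and [t] yields
    levels with value 0. *)
Lemma path_exists (d : Order.disp_t) (T : orderType d) (bot : T) g c (t : T) :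
  (bot < t)%O -> countable [set x : T | (x < t)%O] ->
  (forall a, (a < t)%O -> coherent bot g c a) ->
  exists (b : nat -> T) (v : nat -> nat),
  [/\ b 0 = bot, forall j, (b j < t)%O,
      forall j, path_step g c (b j) (b j.+1) j.+1 (v j.+1),
      forall x m, (x < t)%O -> exists2 j, (m <= j)%N &
        [/\ v j.+1 = 1, (x <= b j)%O & good g c x (b j) j.+1]
    & forall m, exists2 j, (m <= j)%N &
        v j.+1 = 0 /\ good g c (b j) (b j) j.+1].
Proof.
move=> bt ct coh.
have [e [et einf]] := countable_enum_inf (lexx t : [set x : T | (x <= t)%O] t)
  (countable_le ct).
(* [n j] counts the requirements [e 0, e 1, ...] met so far; the sequence idles
   until a level [l] with [act (b j) (e (n j)) l], where it meets the next one.
   The requirement [e n = t] asks for a level at which [g_t] is 0. *)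
pose act (b x : T) l := if x == t then good g c b b l else
  if (x <= b)%O then good g c x b l else good g c b x l.
pose nxt l b n : T * nat * nat :=
  let w0 := if g b l == 2 then 2 else 0 in
  if `[< act b (e n) l >] then
    if e n == t then (b, n.+1, w0) else
    if (e n <= b)%O then (b, n.+1, 1) else (e n, n.+1, 2)
  else (b, n, w0).
pose fix st (j : nat) : T * nat * nat :=
  if j is j'.+1 then nxt j (st j').1.1 (st j').1.2 else (bot, 0, 0).
pose b j := (st j).1.1; pose n j := (st j).1.2; pose v j := (st j).2.
have bS j : b j.+1 = (nxt j.+1 (b j) (n j)).1.1 by [].
have nS j : n j.+1 = (nxt j.+1 (b j) (n j)).1.2 by [].
have vS j : v j.+1 = (nxt j.+1 (b j) (n j)).2 by [].
have b0 : b 0 = bot by [].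
have n0 : n 0 = 0 by [].
clearbody b n v; clear st.
have stepP j : [\/ [/\ ~ act (b j) (e (n j)) j.+1, b j.+1 = b j, n j.+1 = n j
        & v j.+1 = if g (b j) j.+1 == 2 then 2 else 0],
      [/\ act (b j) (e (n j)) j.+1, n j.+1 = (n j).+1, e (n j) = t, b j.+1 = b j
        & v j.+1 = if g (b j) j.+1 == 2 then 2 else 0],
      [/\ act (b j) (e (n j)) j.+1, n j.+1 = (n j).+1, e (n j) <> t /\
          (e (n j) <= b j)%O, b j.+1 = b j & v j.+1 = 1]
    | [/\ act (b j) (e (n j)) j.+1, n j.+1 = (n j).+1, e (n j) <> t /\
          (b j < e (n j))%O, b j.+1 = e (n j) & v j.+1 = 2]].
  rewrite bS nS vS /nxt; case: asboolP => ac; last by constructor 1.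
  case: eqP => ent; first by constructor 2.
  case: leP => enb; first by constructor 3.
  by constructor 4.
have blt j : (b j < t)%O.
  elim: j => [|j IH]; first by rewrite b0.
  have [[_ -> _ _]|[_ _ _ -> _]|[_ _ _ -> _]|[_ _ [ent _] -> _]] // := stepP j.
  by rewrite lt_neqAle et andbT; apply/eqP.
have bmon i j : (i <= j)%N -> (b i <= b j)%O.
  elim: j => [|j IH]; first by rewrite leqn0 => /eqP ->.
  rewrite leq_eqVlt => /orP[/eqP -> //|/IH bij]; apply: (le_trans bij).
  have [[_ -> _ _]|[_ _ _ -> _]|[_ _ _ -> _]|[_ _ [_ /ltW be] -> _]] // := stepP j.
have nle j : (n j <= j)%N.
  elim: j => [|j IH]; first by rewrite n0.
  by have [[_ _ -> _]|[_ -> _ _ _]|[_ -> _ _ _]|[_ -> _ _ _]] := stepP j; lia.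
(* Richness of [b j] supplies the level, or richness of the target [e (n j)] when a jump is due. *)
have act_ex j m : exists2 l, (m < l)%N & act (b j) (e (n j)) l.
  rewrite /act; case: eqP => ent.
    exact: (coh_rich (coh _ (blt j))).
  have elt : (e (n j) < t)%O by rewrite lt_neqAle et andbT; apply/eqP.
  case: leP => enb; first exact: (coh_rich (coh _ (blt j))).
  exact: (coh_rich (coh _ elt) _ (ltW enb)).
(* Idling changes neither [b] nor [n], so a suitable level ahead stays suitable unless an earlier
   one is used. *)
have act_next p j : act (b j) (e (n j)) (j + p).+1 ->
    exists i, n i = n j /\ act (b i) (e (n i)) i.+1.
  elim: p j => [|p IH] j acp; first by exists j; rewrite addn0 in acp.
  have [ac|nac] := pselect (act (b j) (e (n j)) j.+1); first by exists j.
  have [[_ bE nE _]|[]|[]|[]] // := stepP j.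
  by rewrite -nE; apply: IH; rewrite bE nE addSnnS.
have act_at k : exists i, n i = k /\ act (b i) (e (n i)) i.+1.
  elim: k => [|k [i [<- aci]]].
    have [[//|l] _ acl] := act_ex 0 0.
    by have [i []] := act_next l 0 acl; rewrite n0; exists i.
  have nSi : n i.+1 = (n i).+1 by have [[]|[]|[]|[]] := stepP i.
  have [[//|l] li acl] := act_ex i.+1 i.+1.
  have [|i' []] := act_next (l - i.+1) i.+1; first by rewrite subnKC; [|lia].
  by rewrite nSi; exists i'.
have act_inf x m : (x <= t)%O -> exists i, 
    [/\ (m <= i)%N, e (n i) = x & act (b i) (e (n i)) i.+1].
  move=> xt; have [k mk ek] := einf x m xt; have [i [ni aci]] := act_at k.
  by exists i; split; [have := nle i; lia|rewrite ni|].
exists b, v; split=> //.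
- move=> j; have [[_ -> _ ->]|[_ _ _ -> ->]|[ac _ [ent eb] -> ->]|[ac _ [ent be] -> ->]] := stepP j.
  + by constructor 1.
  + by constructor 1.
  + constructor 2; split=> //; exists (e (n j)) => //.
    by move: ac; rewrite /act; case: eqP => // _; rewrite eb.
  + constructor 3; split=> //.
    by move: ac; rewrite /act; case: eqP => // _; rewrite leNgt be.
- move=> x m xt; have nxt' : x <> t by move=> xE; rewrite xE ltxx in xt.
  have [i [_ eni aci]] := act_inf x 0 (ltW xt).
  have xb : (x <= b i.+1)%O.
    have [[]|[_ _ /[!eni]]|[_ _ [_]] /[!eni] xb -> _|[_ _ _ -> _]] // := stepP i.
    by rewrite eni.
  (* Once the sequence has passed [x], meeting the requirement [x] again can only put 1. *)
  have [j [mj enj acj]] := act_inf x (maxn m i.+1) (ltW xt).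
  have xbj : (x <= b j)%O by apply: (le_trans xb); apply: bmon; lia.
  exists j; first lia; have [[]|[_ _ /[!enj]]|[_ _ _ _ vE]|[_ _ [_]]] // := stepP j.
    split=> //; move: acj; rewrite /act enj; case: eqP => // _.
    by rewrite xbj.
  by rewrite enj ltNge xbj.
- move=> m; have [j [mj enj acj]] := act_inf t m (lexx t).
  exists j => //; have gd : good g c (b j) (b j) j.+1.
    by move: acj; rewrite /act enj eqxx.
  have g0 := good_top (coh _ (blt j)) (ltn0Sn j) gd.
  rewrite ltxx in g0.
  by have [[]|[_ _ _ _ ->]|[_ _ []]|[_ _ []]] // := stepP j; rewrite g0.
Qed.

(** * Extending a coherent family by one point *)

Lemma coherent_le (d : Order.disp_t) (T : orderType d) (bot : T) g c (r b a : T) :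
  coherent bot g c b -> coherent bot g c a -> (r <= b)%O -> (b <= a)%O ->
  (c r a <= maxn (c r b) (c b a))%N /\ (c r b <= maxn (c r a) (c b a))%N.
Proof.
move=> cb ca; rewrite le_eqVlt => /predU1P[-> _|rb].
  by rewrite (coh_self cb) leq_maxr.
rewrite le_eqVlt => /predU1P[->|ba]; first by rewrite leq_maxl.
by split; [exact: (coh_ultra ca rb ba)|exact: (coh_tree ca rb ba)].
Qed.

(** [v] becomes g_t and [k y], the first stage acquiring [y], becomes c(y,t); each clause of
    coherence turns into a statement about acquisition. *)
Lemma coherent_extend (d : Order.disp_t) (T : orderType d) (bot : T) g c (t : T)
    (b : nat -> T) (v : nat -> nat) :
  (forall x, (bot <= x)%O) -> (bot < t)%O ->
  (forall a, (a < t)%O -> coherent bot g c a) ->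
  b 0 = bot -> (forall j, (b j < t)%O) ->
  (forall j, path_step g c (b j) (b j.+1) j.+1 (v j.+1)) ->
  (forall x m, (x < t)%O -> exists2 j, (m <= j)%N &
     [/\ v j.+1 = 1, (x <= b j)%O & good g c x (b j) j.+1]) ->
  (forall m, exists2 j, (m <= j)%N & v j.+1 = 0 /\ good g c (b j) (b j) j.+1) ->
  exists k : T -> nat, coherent bot
    (fun y => if y == t then v else g y) (fun y x => if x == t then k y else c y x) t.
Proof.
move=> botle bott coh b0 blt step rich1 rich0.
(* [P y j] says that [y] is acquired by stage [j], that is, [y] lies in P_{j+1}(b_j). *)
pose P y j := (y <= b j)%O /\ (c y (b j) <= j)%N.
have jump j : (b j < b j.+1)%O -> good g c (b j) (b j.+1) j.+1 ->
    forall r, P r j -> (r <= b j.+1)%O /\ (c r (b j.+1) <= j)%N.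
  move=> bb [cb _] r [rb crb]; split; first exact: (le_trans rb (ltW bb)).
  by have [] := coherent_le (coh _ (blt j)) (coh _ (blt j.+1)) rb (ltW bb); lia.
have PS y j : P y j -> P y j.+1.
  move=> Pyj; have [[bE _]|[bE _ _]|[bb _ gd]] := step j.
  - by case: Pyj => yb cyb; split; rewrite bE //; exact: leqW.
  - by case: Pyj => yb cyb; split; rewrite bE //; exact: leqW.
  - by have [? ?] := jump _ bb gd _ Pyj; split=> //; exact: leqW.
have Pmon y i j : (i <= j)%N -> P y i -> P y j.
  move=> /subnK <- Pi; elim: (j - i)%N => [//|p IH]; exact: PS.
have Pex y : (y < t)%O -> exists j, P y j.
  by move=> yt; have [j _ [_ yb [cy _]]] := rich1 _ 0 yt; exists j.
pose k y := if y == t then 0 else xget 0 [set j | P y j /\ forall i, P y i -> (j <= i)%N].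
have kP y j : (y < t)%O -> (k y <= j)%N <-> P y j.
  move=> yt; rewrite /k lt_eqF //; case: xgetP => [m _ [Pm mmin]|/= nex].
    by split=> [mj|/mmin//]; exact: Pmon Pm.
  have exb : exists i, `[< P y i >] by have [i Pi] := Pex _ yt; exists i; apply/asboolP.
  case: (ex_minnP exb) => m /asboolP Pm mmin; case: (nex m); split=> // i Pi.
  by apply: mmin; apply/asboolP.
(* Once [x] is acquired, the acquired points up to [x] are exactly those of P_{j+1}(x); this gives
   both [coh_ultra] and [coh_tree] at [t]. *)
have Ptri y x j : (y <= x)%O -> (x < t)%O -> P x j -> P y j <-> (c y x <= j)%N.
  move=> yx xt [xb cxb].
  have [] := coherent_le (coh _ xt) (coh _ (blt j)) yx xb.
  by rewrite /P (le_trans yx xb); split=> [[_ ?]|?]; [lia|split=> //; lia].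
have kt : k t = 0 by rewrite /k eqxx.
have knew y j : (bot < y)%O -> (y < t)%O -> P y j.+1 -> ~ P y j ->
    g y j.+1 = 1 /\ v j.+1 = 2.
  move=> boty yt [yb cyb] nP.
  (* Without a jump, [y] can enter only because c(y,b_j) is exactly j+1, where [coh_col] for [b j]
     prescribes the values 1 and 2. *)
  have same : b j.+1 = b j -> g y j.+1 = 1 /\ g (b j) j.+1 = 2.
    move=> bE; rewrite bE in yb cyb.
    have cE : c y (b j) = j.+1.
      apply/eqP; rewrite eqn_leq cyb ltnNge; apply/negP => ?; exact: nP.
    rewrite -cE; apply: (coh_col (coh _ (blt j))) => //.
    rewrite lt_neqAle yb andbT; apply/eqP => yE.
    by move: cE; rewrite yE (coh_self (coh _ (blt j))).
  have [[bE ->]|[bE vE [x xb gd]]|[bb -> gd]] := step j.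
  - by have [-> ->] := same bE.
  (* No point enters when 1 is put: goodness gives [b j] the value 0 or 1 there, not 2. *)
  - have [_ g2] := same bE; have := good_top (coh _ (blt j)) (ltn0Sn j) gd.
    by rewrite g2; case: (_ < _)%O.
  (* After a jump the top has value 1, so [coh_col] excludes c(y,b_{j+1}) = j+1. Hence goodness
     determines the value at [y], and it is 1, since a point up to [b j] would have been acquired
     already. *)
  - have := good_top (coh _ (blt j.+1)) (ltn0Sn j) gd; rewrite bb => g1.
    have cl : (c y (b j.+1) < j.+1)%N.
      rewrite ltn_neqAle cyb andbT; apply/eqP => cE.
      have ylt : (y < b j.+1)%O.
        rewrite lt_neqAle yb andbT; apply/eqP => yE.
        by move: cE; rewrite yE (coh_self (coh _ (blt j.+1))).
      have [_] := coh_col (coh _ (blt j.+1)) boty ylt.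
      by rewrite cE g1.
    split=> //; rewrite (gd.2 _ yb cl).
    case: ltP => // yb'; case: nP; split=> //.
    have [_] := coherent_le (coh _ (blt j)) (coh _ (blt j.+1)) yb' (ltW bb).
    by have := gd.1; lia.
have kfree y j : (y < t)%O -> P y j ->
    ~ (g y j.+1 = 1 /\ v j.+1 = 2) /\ ~ (g y j.+1 = 2 /\ v j.+1 = 1).
  move=> yt Py; have [[bE ->]|[bE -> [x xb gd]]|[bb -> gd]] := step j.
  (* Imitation keeps the value 2 and sends all others to 0, so the only possible conflict is one
     that [coh_free] excludes for [b j]. *)
  - case: eqP => [g2|_]; last by split=> -[].
    split=> -[] // g1 _; case: Py => yb cyb.
    move: yb; rewrite le_eqVlt => /predU1P[yE|ylt]; first by rewrite yE g2 in g1.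
    by have [[]] := coh_free (coh _ (blt j)) ylt (cyb : (c y (b j) < j.+1)%N).
  - split=> -[] // g2 _; case: Py => yb cyb.
    by move: g2; rewrite (gd.2 _ yb cyb); case: (_ < _)%O.
  - split=> -[] // g1 _; have [yb' cyb'] := jump _ bb gd _ Py.
    by move: g1; rewrite (gd.2 _ yb' cyb') ltNge Py.1.
exists k; split=> [|||x m xt|r x|r x|m|x m]; rewrite ?eqxx ?kt //.
- by apply/eqP; rewrite -leqn0; apply/kP => //; split; rewrite b0 ?(coh_self (coh _ bott)).
- move=> x botx xt; rewrite lt_eqF //.
  (* Stage 0 acquires only [bot], so [x] is newly acquired at a successor stage and [knew]
     applies. *)
  case kE: (k x) => [|j].
    have /(kP _ _ xt) [] : (k x <= 0)%N by rewrite kE.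
    by rewrite b0 leNgt botx.
  by apply: knew => //; [apply/kP; rewrite ?kE|move/(kP _ _ xt); rewrite kE ltnn].
- by case: m => // j kj; rewrite lt_eqF //; apply: kfree => //; apply/kP.
- move=> rx xt; rewrite lt_eqF //; have rt := lt_trans rx xt.
  have Px : P x (maxn (c r x) (k x)) by apply/kP; rewrite ?leq_maxr.
  by apply/kP => //; apply/(Ptri r x _ (ltW rx) xt Px); rewrite leq_maxl.
- move=> rx xt; rewrite lt_eqF //; have rt := lt_trans rx xt.
  have Px : P x (maxn (k r) (k x)) by apply/kP; rewrite ?leq_maxr.
  by apply/(Ptri r x _ (ltW rx) xt Px)/kP; rewrite ?leq_maxl.
(* All points acquired before stage [m] are still acquired at stage [m], hence lie in the finite set
   P_{m+1}(b_m). *)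
- apply: (@sub_finite_set _ _ ([set b m] `|` [set x | (x < b m)%O /\ (c x (b m) < m.+1)%N])).
    move=> x /= [xt kx]; have [xb cx] : P x m by apply/kP => //; exact: ltnW.
    by move: xb; rewrite le_eqVlt => /predU1P[]; [left|right].
  by rewrite finite_setU; split; [exact: finite_set1|exact: (coh_fin (coh _ (blt m)))].
(* For [x = t] all acquired points and [t] must carry 0, which is [rich0]; for [x] below [t] the
   point [t] must carry 1, which is [rich1]. *)
- rewrite le_eqVlt => /predU1P[->|xt].
    have [j mj [vj gd]] := rich0 m; exists j.+1 => //; split; first by rewrite eqxx kt.
    move=> r; rewrite eqxx le_eqVlt => /predU1P[->|rt]; first by rewrite eqxx ltxx.
    rewrite ltnS => /(kP _ _ rt) [rb crb]; rewrite lt_eqF // (gd.2 _ rb crb).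
    by rewrite !ltNge rb ltW.
  have [j mj [vj xb gd]] := rich1 x m xt; exists j.+1 => //; split.
    by rewrite eqxx ltnS; apply/kP => //; split=> //; exact: gd.1.
  move=> r; rewrite eqxx le_eqVlt => /predU1P[->|rt]; first by rewrite eqxx xt.
  by rewrite ltnS => /(kP _ _ rt) [rb crb]; rewrite lt_eqF // (gd.2 _ rb crb).
Qed.

(** * The full recursion *)

Lemma coherent_exists (d : Order.disp_t) (T : orderType d) (bot : T) :
  well_order (<=%O : rel T) -> (forall x, (bot <= x)%O) ->
  (forall a : T, countable [set b : T | (b < a)%O]) ->
  exists (g : T -> nat -> nat) (c : T -> T -> nat), forall a, coherent bot g c a.
Proof.
move=> wo botle cnt.
pose Q (h : T -> (nat -> nat) * (T -> nat)) a :=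
  coherent bot (fun y => (h y).1) (fun y x => (h x).2 y) a.
have [|h h' x hh|h x IH|h Qh] :=
    wf_sequence (Q := Q) (lt := fun x y : T => (x < y)%O) (wo_lt_wf wo).
- by split=> _; exact: 0.
- apply: coherent_local => [y|r y]; rewrite le_eqVlt => /predU1P[->|yx]; rewrite hh //;
    by [right|left].
- have [xE|xbot] := eqVneq x bot; last have bx : (bot < x)%O by rewrite lt_neqAle eq_sym xbot botle.
    (* The zero functions work at [bot], where every positive level is good. *)
    exists (fun=> 0, fun=> 0); rewrite xE; split=> /=; rewrite ?asboolT //.
    + by move=> y /lt_trans/[apply]; rewrite ltxx.
    + by move=> y k; rewrite ltNge botle.
    + by move=> r y _; rewrite ltNge botle.
    + move=> m; apply: (@sub_finite_set _ _ set0) => // y /= [].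
      by rewrite ltNge botle.
    + move=> y m yb; exists m.+1 => //; split; rewrite asboolT // => r rb _.
      have -> : r = bot by apply/eqP; rewrite eq_le rb botle.
      by rewrite asboolT // ltNge botle.
  have [b [v [b0 blt step rich1 rich0]]] := path_exists bx (cnt x) IH.
  have [k ck] := coherent_extend botle bx IH b0 blt step rich1 rich0.
  exists (v, k); apply: coherent_local ck => [y _|r y _]; case: asboolP => [->|/eqP/negPf ->];
    by rewrite ?eqxx.
- by exists (fun y => (h y).1), (fun y x => (h x).2 y).
Qed.

(** * Successors, and recoding into three values *)

(** A maximal point would make [T] a countable closed initial segment, so [s a] can be the least
    point above [a]. *)
Lemma omega1_succ (d : Order.disp_t) (T : orderType d) :
  is_omega1 T -> exists s : T -> T,
    (forall a, (a < s a)%O) /\ {homo s : a b / (a < b)%O}.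
Proof.
move=> [wo unc cnt].
have ex (a : T) : exists b, (a < b)%O /\ forall x, (a < x)%O -> (b <= x)%O.
  have [|z az zm] := wo_min (A := [set x | (a < x)%O]) wo; last by exists z.
  apply: contrapT => /forallNP amax; apply: unc.
  apply: sub_countable (countable_le (cnt a)); apply: subset_card_le => x _ /=.
  by rewrite leNgt; apply/negP => ax; exact: amax ax.
have [s sP] := choice ex.
exists s; split=> [a|a b ab]; first by have [] := sP a.
by apply: le_lt_trans (sP b).1; apply: (sP a).2.
Qed.

(** Collapsing all values other than 1 and 2 to 0 spares the recursion from tracking a bound on
    [g]. *)
Definition ord3 (n : nat) : 'I_3 :=
  if n == 1 then @Ordinal 3 1 isT else if n == 2 then @Ordinal 3 2 isT else ord0.

Lemma ord3_eq1 n : (ord3 n = 1 :> nat) <-> n = 1.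
Proof. by rewrite /ord3; case: n => [|[|[|]]]. Qed.

Lemma ord3_eq2 n : (ord3 n = 2 :> nat) <-> n = 2.
Proof. by rewrite /ord3; case: n => [|[|[|]]]. Qed.

Lemma infinite_nat (A : set nat) :
  (forall m, exists2 k, (m <= k)%N & A k) -> infinite_set A.
Proof.
move=> Aub /finite_seqP[s As]; have [k] := Aub (\max_(i <- s) i).+1.
by rewrite As /= ltnNge => /negP kmax ks; case: kmax; exact: leq_bigmax_seq ks _.
Qed.

Theorem theorem3p1 (d : Order.disp_t) (omega1 : orderType d)
    (homega1 : is_omega1 omega1) :
  exists (g : omega1 -> nat -> 'I_3) (c : two_subsets omega1 -> nat),
    [/\ forall b a : omega1, (b < a)%O -> forall k : nat, (col c b a < k)%N ->
          [set (g b k : nat); (g a k : nat)] <> [set 1; 2],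
        forall b a : omega1, (b < a)%O ->
          g b (col c b a) = 1 :> nat /\ g a (col c b a) = 2 :> nat,
        forall r b a : omega1, (r < b)%O -> (b < a)%O ->
          (col c a b < col c r b)%N -> col c r b = col c r a,
        forall (a : omega1) (m : nat),
          finite_set [set b : omega1 | (b < a)%O /\ (col c b a < m)%N]
      & forall a : omega1,
          infinite_set [set k : nat | g a k = 1 :> nat] /\
          infinite_set [set k : nat | g a k = 2 :> nat]].
Proof.
have [wo unc cnt] := homega1.
have [bot _ botle] : exists2 bot : omega1, True & forall x, (bot <= x)%O.
  have [|z _ zm] := wo_min (A := [set: omega1]) wo; last by exists z => // x; exact: zm.
  apply: contrapT => /forallNP nT; apply: unc.
  rewrite (_ : [set: omega1] = set0); first exact: countable0.
  by apply/seteqP; split=> // x _; case: (nT x).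
have [s [sgt shomo]] := omega1_succ homega1.
have [g [c coh]] := coherent_exists wo botle cnt.
have sbot a : (bot < s a)%O by exact: le_lt_trans (botle a) (sgt a).
(* Level [k] of the coherent family is moved to the odd level 2k+1. *)
have [c' c'E] := exists_col (fun b a => (c (s b) (s a)).*2.+1).
(* The even levels, where all the functions are 2, serve only for (5). *)
exists (fun a k => ord3 (if odd k then g (s a) k./2 else 2)), c'; split.
- move=> b a ba k; rewrite c'E // => ck E.
  have [kodd|kev] := boolP (odd k); last first.
    rewrite (negPf kev) in E.
    by have [] : [set 2; 2] 1 by rewrite [X in X _]E; left.
  rewrite kodd in E.
  have ck' : (c (s b) (s a) < k./2)%N by lia.
  have [n1 n2] := coh_free (coh (s a)) (shomo _ _ ba) ck'.
  have [/= e1|/= e1] : [set 1; 2] (ord3 (g (s b) k./2) : nat) by rewrite -E; left.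
    have : [set 1; 2] 2 by right.
    by rewrite -E => -[] /= /esym e2; [rewrite e1 in e2|case: n1; split; [apply/ord3_eq1|apply/ord3_eq2]].
  have : [set 1; 2] 1 by left.
  by rewrite -E => -[] /= /esym e2; [rewrite e1 in e2|case: n2; split; [apply/ord3_eq2|apply/ord3_eq1]].
- move=> b a ba; rewrite c'E //= odd_double /= uphalf_double.
  by rewrite ord3_eq1 ord3_eq2; exact: (coh_col (coh (s a)) (sbot b) (shomo _ _ ba)).
- move=> r b a rb ba; rewrite (colC _ a b) !c'E //; last exact: lt_trans ba.
  (* If c(b,a) < c(r,b), then [coh_tree] gives c(r,b) <= c(r,a) and [coh_ultra] the converse. *)
  have := coh_ultra (coh (s a)) (shomo _ _ rb) (shomo _ _ ba).
  have := coh_tree (coh (s a)) (shomo _ _ rb) (shomo _ _ ba).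
  lia.
- move=> a m; have fin := coh_fin (coh (s a)) m.
  apply: sub_finite_set (finite_preimage (f := s) _ fin).
    by move=> b /= [ba]; rewrite c'E // => cm; split; [exact: shomo|lia].
  move=> x y _ _ sxy; have [xy|xy|//] := ltgtP x y.
    by have := shomo _ _ xy; rewrite sxy ltxx.
  by have := shomo _ _ xy; rewrite sxy ltxx.
- move=> a; split; apply: infinite_nat => m.
    (* Levels good for [bot] give [s a] the value 1, because [s a] lies strictly above [bot]. *)
    have [l ml gl] := coh_rich (coh (s a)) m (botle (s a)).
    exists l.*2.+1; first lia.
    rewrite /= odd_double /= uphalf_double ord3_eq1.
    by rewrite (good_top (coh _) _ gl) ?sbot //; lia.
  by exists m.*2; [lia|rewrite /= odd_double].
Qed.
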